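(* Let $H=(H_1,\dots,H_5):\mathbb{Q}^5\to\mathbb{Q}^5$ be the polynomial map given by $$H_1=0,\quad H_2=X_1X_3,\quad H_3=X_1X_4+\tfrac12X_2^2,\quad H_4=X_1X_5-X_2X_3,\quad H_5=\tfrac12X_3^2,$$ and let $F=\mathrm{Id}+H:\mathbb{Q}^5\to\mathbb{Q}^5$ (the Vasyunin map). Then $F$ is invertible, but $F$ is not Pascal finite.
   Context: A polynomial map $F:K^n\to K^n$ over a field $K$ is a tuple $F=(F_1,\dots,F_n)$ of polynomials $F_i\in K[X]=K[X_1,\dots,X_n]$; composition means substitution of polynomials. $F$ is invertible if there is a polynomial map $G:K^n\to K^n$ with $F\circ G=\mathrm{Id}$ and $G\circ F=\mathrm{Id}$. Pascal finite: for a polynomial map $F$ define $\Delta_F:K[X]^n\to K[X]^n$ by $\Delta_F(P)=P\circ F-P$. The map $F$ is Pascal finite if there exists a positive integer $m$ such that $\Delta_F^m(X)=0$, where $\Delta_F^m$ is the $m$-fold iterate of $\Delta_F$ and $X=(X_1,\dots,X_n)$ is the identity map. *)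

(* Defs.v *)
From HB Require Import structures.
From mathcomp Require Import all_boot all_order all_algebra.
From mathcomp Require Export mpoly.

Set Implicit Arguments.
Unset Strict Implicit.
Unset Printing Implicit Defensive.

Import GRing.Theory.

Local Open Scope ring_scope.

Section PolyMap.
Variables (K : fieldType) (n : nat).

(* A polynomial map K^n -> K^n is the tuple of its component polynomials, not
   the function it induces on the points of K^n. *)
Definition polymap := n.-tuple {mpoly K[n]}.

Implicit Types F G P : polymap.

Definition pm0 : polymap := [tuple 0 | i < n].

Definition pm_id : polymap := [tuple 'X_i | i < n].

Definition pm_add P F : polymap := [tuple tnth P i + tnth F i | i < n].

Definition pm_sub P F : polymap := [tuple tnth P i - tnth F i | i < n].

(* P o F: F is substituted into each component of P. *)
Definition pm_comp P F : polymap := [tuple tnth P i \mPo F | i < n].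

Definition pm_invertible F : Prop :=
  exists G, pm_comp F G = pm_id /\ pm_comp G F = pm_id.

Definition Delta F P : polymap := pm_sub (pm_comp P F) P.

Definition pascal_finite F : Prop :=
  exists m : nat, (0 < m)%N /\ iter m (Delta F) pm_id = pm0.

End PolyMap.

Definition vasyunin_H : polymap rat 5 :=
  let X1 := 'X_(@Ordinal 5 0 isT) in
  let X2 := 'X_(@Ordinal 5 1 isT) in
  let X3 := 'X_(@Ordinal 5 2 isT) in
  let X4 := 'X_(@Ordinal 5 3 isT) in
  let X5 := 'X_(@Ordinal 5 4 isT) in
  [tuple 0;
         X1 * X3;
         X1 * X4 + (1 / 2) *: X2 ^+ 2;
         X1 * X5 - X2 * X3;
         (1 / 2) *: X3 ^+ 2].

Definition vasyunin : polymap rat 5 := pm_add (pm_id rat 5) vasyunin_H.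

(* Main.v *)
Require Import Defs.
From mathcomp Require Import all_boot all_order all_algebra.
From mathcomp Require Import ring.

(** Invertibility: writing [Y = F(X)], the polynomial
    [Y_3 - Y_1 (Y_4 - Y_1 Y_5) - Y_2^2 / 2] equals [X_3]; the other coordinates
    are then recovered in the order [X_2], [X_5], [X_4].

    Failure of Pascal finiteness: if [Delta_F^m X = 0], then along every orbit
    of [F] each coordinate is a sequence killed by the [m]-th finite difference.
    In the coordinates [X = 2 Y] the map [F] has integer coefficients, so it can
    be reduced modulo 7.  There the orbit of [Y = (1,1,1,1,1)] has period 10;
    as 10 is invertible modulo 7, a 10-periodic sequence killed by an iterated
    difference is constant, but the second coordinate of this orbit is not. *)

Set Implicit Arguments.
Unset Strict Implicit.
Unset Printing Implicit Defensive.

Import GRing.Theory.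

Local Open Scope ring_scope.

Definition seq_diff (V : zmodType) (a : nat -> V) (k : nat) : V := a k.+1 - a k.

Lemma eq_iter_seq_diff (V : zmodType) (m : nat) (a b : nat -> V) :
  a =1 b -> iter m (@seq_diff V) a =1 iter m (@seq_diff V) b.
Proof. by move=> eq_ab; elim: m => [|m IHm] k //=; rewrite /seq_diff !IHm. Qed.

Lemma raddf_iter_seq_diff (U V : zmodType) (f : {additive U -> V}) (m : nat)
    (a : nat -> U) (k : nat) :
  iter m (@seq_diff V) (f \o a) k = f (iter m (@seq_diff U) a k).
Proof. by elim: m k => [|m IHm] k //=; rewrite /seq_diff !IHm raddfB. Qed.

(* If [seq_diff a] is constantly [c], then summing it over a period gives
   [N%:R * c = 0]. *)
Lemma periodic_iter_seq_diff0 (K : fieldType) (N m : nat) (a : nat -> K) :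
    N%:R != 0 :> K -> (forall k, a (N + k)%N = a k) ->
    (forall k, iter m (@seq_diff K) a k = 0) ->
  forall k, seq_diff a k = 0.
Proof.
move=> N_neq0; elim: m a => [|m IHm] a a_per.
  by move=> /= a0 k; rewrite /seq_diff !a0 subrr.
(* The extra difference is moved innermost, so that the induction hypothesis applies to
   [seq_diff a], which is again [N]-periodic. *)
rewrite iterSr => da0.
have da_per k : seq_diff a (N + k)%N = seq_diff a k.
  by rewrite /seq_diff -addnS !a_per.
have da_const k : seq_diff a k = seq_diff a 0%N.
  by elim: k => // k <-; apply/eqP; rewrite -subr_eq0 (IHm _ da_per da0 k : _ - _ = _).
suff da00 : seq_diff a 0%N = 0 by move=> k; rewrite da_const.
have a_lin k : a k = a 0%N + k%:R * seq_diff a 0%N.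
  elim: k => [|k IHk]; first by rewrite mul0r addr0.
  by rewrite -natr1 mulrDl mul1r addrA -IHk -(da_const k) addrC subrK.
have /eqP := a_lin N.
rewrite -[N in a N]addn0 a_per eq_sym addrC -subr_eq0 addrK mulf_eq0.
by rewrite (negPf N_neq0) => /eqP.
Qed.

(** Evaluating [P] composed with [F] at [v l] means evaluating [P] at [v l.+1], so [Delta F] acts
    along an orbit as the difference operator. *)
Lemma tnth_iter_Delta_meval (K : fieldType) (n : nat) (F P : polymap K n)
    (v : nat -> 'I_n -> K) (m : nat) (i : 'I_n) (k : nat) :
    (forall l j, (tnth F j).@[v l] = v l.+1 j) ->
  (tnth (iter m (Delta F) P) i).@[v k] =
    iter m (@seq_diff K) (fun l => (tnth P i).@[v l]) k.
Proof.
move=> vF; elim: m k => [|m IHm] k //=.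
rewrite /Delta /pm_sub /pm_comp !tnth_mktuple mevalB comp_mpoly_meval.
by rewrite (meval_eq _ (vF k)) /seq_diff !IHm.
Qed.

Lemma pascal_finite_orbit (K : fieldType) (n : nat) (F : polymap K n)
    (v : nat -> 'I_n -> K) (i : 'I_n) :
    pascal_finite F -> (forall l j, (tnth F j).@[v l] = v l.+1 j) ->
  exists m, forall k, iter m (@seq_diff K) (fun l => v l i) k = 0.
Proof.
move=> [m [_ Dm0]] vF; exists m => k.
have := tnth_iter_Delta_meval (pm_id K n) m i k vF.
rewrite Dm0 /pm0 /pm_id !tnth_mktuple meval0 => ->.
by apply: eq_iter_seq_diff => l; rewrite mevalXU.
Qed.

(* [F (2 y) = 2 (int_vasyunin y)]. *)
Definition int_vasyunin (R : comNzRingType) (y : 5.-tuple R) : 5.-tuple R :=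
  let y1 := tnth y (@Ordinal 5 0 isT) in
  let y2 := tnth y (@Ordinal 5 1 isT) in
  let y3 := tnth y (@Ordinal 5 2 isT) in
  let y4 := tnth y (@Ordinal 5 3 isT) in
  let y5 := tnth y (@Ordinal 5 4 isT) in
  [tuple y1;
         y2 + 2 * (y1 * y3);
         y3 + 2 * (y1 * y4) + y2 ^+ 2;
         y4 + 2 * (y1 * y5) - 2 * (y2 * y3);
         y5 + y3 ^+ 2].

Definition int_vasyunin_orbit (R : comNzRingType) (k : nat) : 5.-tuple R :=
  iter k (@int_vasyunin R) [tuple 1; 1; 1; 1; 1].

(** No ring morphism goes from [rat] to ['F_7]; the orbit over [int] maps to both and links them. *)
Lemma rmorph_int_vasyunin_orbit (R S : comNzRingType) (f : {rmorphism R -> S})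
    (k : nat) (i : 'I_5) :
  tnth (int_vasyunin_orbit S k) i = f (tnth (int_vasyunin_orbit R k) i).
Proof.
elim: k i => [|k IHk] i.
  by case: i => -[|[|[|[|[|//]]]]] lti5; rewrite !(tnth_nth 0) /= rmorph1.
rewrite /int_vasyunin_orbit !iterS -!/(int_vasyunin_orbit _ _).
by case: i => -[|[|[|[|[|//]]]]] lti5;
  rewrite [LHS](tnth_nth 0) [X in f X](tnth_nth 0) /= !IHk;
  rewrite ?(rmorph_nat, rmorphB, rmorphD, rmorphM, rmorphXn).
Qed.

Lemma meval_vasyunin (y : 5.-tuple rat) (i : 'I_5) :
  (tnth vasyunin i).@[fun j => 2 * tnth y j] = 2 * tnth (int_vasyunin y) i.
Proof.
rewrite /vasyunin /pm_add /pm_id !tnth_mktuple mevalD mevalXU.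
by case: i => -[|[|[|[|[|//]]]]] lti5;
  rewrite (bool_irrelevance lti5 isT) //;
  rewrite [tnth vasyunin_H _](tnth_nth 0) /=;
  rewrite [tnth (int_vasyunin _) _](tnth_nth 0) /=;
  rewrite ?(meval0, mevalB, mevalD, mevalZ, mevalM, rmorphXn) /= ?mevalXU; field.
Qed.

Lemma int_vasyunin_orbit_F7 (k : nat) :
  int_vasyunin_orbit 'F_7 (10 + k) = int_vasyunin_orbit 'F_7 k.
Proof.
(* Only the return to the starting point after ten steps is left to compute. *)
rewrite addnC /int_vasyunin_orbit iterD; congr (iter k _ _).
by apply/eqP; vm_compute.
Qed.

Lemma vasyunin_not_pascal_finite : ~ pascal_finite vasyunin.
Proof.
pose i1 := @Ordinal 5 1 isT.
pose v k j := 2 * tnth (int_vasyunin_orbit rat k) j.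
move=> /(@pascal_finite_orbit _ _ _ v i1) [l j|m dm0].
  by rewrite meval_vasyunin.
(* The vanishing of the differences is pulled back from [rat] to [int] by injectivity, then pushed
   forward to ['F_7]. *)
pose a k : int := 2 * tnth (int_vasyunin_orbit int k) i1.
have a0 k : iter m (@seq_diff int) a k = 0.
  apply/eqP; rewrite -(intr_eq0 rat) -(raddf_iter_seq_diff (intmul 1)) -(dm0 k).
  apply/eqP/eq_iter_seq_diff => l.
  by rewrite /v /= rmorphM rmorph_nat -(rmorph_int_vasyunin_orbit (intmul 1)).
pose b k : 'F_7 := 2 * tnth (int_vasyunin_orbit 'F_7 k) i1.
have b0 k : iter m (@seq_diff 'F_7) b k = 0.
  rewrite (@eq_iter_seq_diff _ m _ (intmul 1 \o a)) => [|l].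
    by rewrite raddf_iter_seq_diff a0.
  by rewrite /b /= rmorphM rmorph_nat -(rmorph_int_vasyunin_orbit (intmul 1)).
have b_per k : b (10 + k)%N = b k by rewrite /b int_vasyunin_orbit_F7.
(* Here [isT] certifies that 10 is nonzero modulo 7. The second coordinate moves from 1 to 3, so
   [b 1 - b 0] is 4, not 0. *)
have /eqP := @periodic_iter_seq_diff0 _ 10 m b isT b_per b0 0%N.
by vm_compute.
Qed.

(* [vasyunin] and its inverse as operations on 5-tuples of an arbitrary
   commutative ring, [h] standing for [1/2]. *)
Definition vasyunin_fun (R : comNzRingType) (h : R) (x : 5.-tuple R) :
    5.-tuple R :=
  let x1 := tnth x (@Ordinal 5 0 isT) in
  let x2 := tnth x (@Ordinal 5 1 isT) in
  let x3 := tnth x (@Ordinal 5 2 isT) in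
  let x4 := tnth x (@Ordinal 5 3 isT) in
  let x5 := tnth x (@Ordinal 5 4 isT) in
  [tuple x1;
         x2 + x1 * x3;
         x3 + (x1 * x4 + h * x2 ^+ 2);
         x4 + (x1 * x5 - x2 * x3);
         x5 + h * x3 ^+ 2].

Definition vasyunin_inv_fun (R : comNzRingType) (h : R) (y : 5.-tuple R) :
    5.-tuple R :=
  let y1 := tnth y (@Ordinal 5 0 isT) in
  let y2 := tnth y (@Ordinal 5 1 isT) in
  let y3 := tnth y (@Ordinal 5 2 isT) in
  let y4 := tnth y (@Ordinal 5 3 isT) in
  let y5 := tnth y (@Ordinal 5 4 isT) in
  let x3 := y3 - y1 * (y4 - y1 * y5) - h * y2 ^+ 2 in
  let x2 := y2 - y1 * x3 in
  let x5 := y5 - h * x3 ^+ 2 in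
  let x4 := y4 - y1 * x5 + x2 * x3 in
  [tuple y1; x2; x3; x4; x5].

Lemma eq_tuple5 (R : nmodType) (s t : 5.-tuple R) :
    s`_0 = t`_0 -> s`_1 = t`_1 -> s`_2 = t`_2 -> s`_3 = t`_3 ->
    s`_4 = t`_4 -> s = t.
Proof.
move=> e0 e1 e2 e3 e4; apply: eq_from_tnth => i; rewrite !(tnth_nth 0).
by case: i => -[|[|[|[|[|//]]]]].
Qed.

Section VasyuninFun.
Variables (R S : comNzRingType) (f : {rmorphism R -> S}) (h : R).
Implicit Type x : 5.-tuple R.

(** Substituting a polynomial map is a ring morphism, so this naturality turns composition of
    polynomial maps into applying the operation to a tuple. *)
Lemma map_vasyunin_fun x :
  map_tuple f (vasyunin_fun h x) = vasyunin_fun (f h) (map_tuple f x).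
Proof.
by apply: eq_tuple5; rewrite /= ?tnth_map ?(rmorphB, rmorphD, rmorphM, rmorphXn).
Qed.

Lemma map_vasyunin_inv_fun x :
  map_tuple f (vasyunin_inv_fun h x) = vasyunin_inv_fun (f h) (map_tuple f x).
Proof.
by apply: eq_tuple5; rewrite /= ?tnth_map ?(rmorphB, rmorphD, rmorphM, rmorphXn).
Qed.

Hypothesis hh1 : h + h = 1.

(** The cross term is [(h + h) * (u * v)]. Both inverse laws use [h + h = 1] only through this
    expansion. *)
Lemma half_sqrD (u v : R) : h * (u + v) ^+ 2 = h * u ^+ 2 + u * v + h * v ^+ 2.
Proof.
by rewrite -[u * v]mul1r -hh1; ring.
Qed.

Lemma vasyunin_inv_funK x : vasyunin_fun h (vasyunin_inv_fun h x) = x.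
Proof.
apply: eq_tuple5; rewrite /= !(tnth_nth 0) /= !(tnth_nth 0); try by ring.
(* Only the third component is left. With [x3] opaque, the second entry is split as its preimage
   coordinate plus the first entry times [x3], and its halved square is expanded. *)
set x3 := x`_2 - _ - _.
have -> : x`_2 = x3 + x`_0 * (x`_3 - x`_0 * x`_4) + h * x`_1 ^+ 2.
  by rewrite /x3; ring.
have := half_sqrD (x`_1 - x`_0 * x3) (x`_0 * x3); rewrite subrK => ->.
by ring.
Qed.

Lemma vasyunin_funK x : vasyunin_inv_fun h (vasyunin_fun h x) = x.
Proof.
(* The inverse recovers the third coordinate first; once it is simplified, the coordinates built
   from it are plain ring identities. *)
have x3E : x`_2 + (x`_0 * x`_3 + h * x`_1 ^+ 2) -
    x`_0 * (x`_3 + (x`_0 * x`_4 - x`_1 * x`_2) - x`_0 * (x`_4 + h * x`_2 ^+ 2)) -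
    h * (x`_1 + x`_0 * x`_2) ^+ 2 = x`_2.
  by rewrite half_sqrD; ring.
by apply: eq_tuple5; rewrite /= !(tnth_nth 0) /= !(tnth_nth 0) ?x3E //; ring.
Qed.

End VasyuninFun.

Lemma pm_compE (K : fieldType) (n : nat) (P F : polymap K n) :
  pm_comp P F = map_tuple (comp_mpoly F) P.
Proof. by apply: eq_from_tnth => i; rewrite tnth_mktuple tnth_map. Qed.

Lemma pm_comp_id (K : fieldType) (n : nat) (F : polymap K n) :
  map_tuple (comp_mpoly F) (pm_id K n) = F.
Proof.
apply: eq_from_tnth => i.
by rewrite tnth_map tnth_mktuple comp_mpolyXU -tnth_nth.
Qed.

Lemma pm_comp_vasyunin_fun (K : fieldType) (c : K) (F : polymap K 5) :
  pm_comp (vasyunin_fun c%:MP (pm_id K 5)) F = vasyunin_fun c%:MP F.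
Proof. by rewrite pm_compE map_vasyunin_fun pm_comp_id /= comp_mpolyC. Qed.

Lemma pm_comp_vasyunin_inv_fun (K : fieldType) (c : K) (F : polymap K 5) :
  pm_comp (vasyunin_inv_fun c%:MP (pm_id K 5)) F = vasyunin_inv_fun c%:MP F.
Proof. by rewrite pm_compE map_vasyunin_inv_fun pm_comp_id /= comp_mpolyC. Qed.

Lemma vasyunin_fun_invertible (K : fieldType) (c : K) :
  c + c = 1 -> pm_invertible (vasyunin_fun c%:MP (pm_id K 5)).
Proof.
move=> cc1.
have hh1 : c%:MP + c%:MP = 1 :> {mpoly K[5]} by rewrite -mpolyCD cc1.
exists (vasyunin_inv_fun c%:MP (pm_id K 5)).
rewrite pm_comp_vasyunin_fun pm_comp_vasyunin_inv_fun.
by rewrite vasyunin_inv_funK ?vasyunin_funK.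
Qed.

Lemma vasyuninE : vasyunin = vasyunin_fun (1 / 2)%:MP (pm_id rat 5).
Proof.
apply: eq_from_tnth => i.
rewrite /vasyunin /pm_add /pm_id tnth_mktuple [tnth vasyunin_H _](tnth_nth 0).
rewrite [RHS](tnth_nth 0).
by case: i => -[|[|[|[|[|//]]]]] lti5;
  rewrite /= !tnth_mktuple ?mul_mpolyC ?addr0 (bool_irrelevance lti5 isT).
Qed.

Lemma vasyunin_invertible : pm_invertible vasyunin.
Proof. by rewrite vasyuninE; apply: vasyunin_fun_invertible. Qed.

Theorem proposition6p1 : pm_invertible vasyunin /\ ~ pascal_finite vasyunin.
Proof. exact: conj vasyunin_invertible vasyunin_not_pascal_finite. Qed.
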